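(* For any natural number $n$ and any numbers $\alpha,\beta$ with $(\alpha,\beta)\ne(0,0)$, the ratio $$\frac{\Omega_0\big(\lfloor n/2\rfloor\,|\,\alpha,\beta\,|\,n\big)}{(n-1)(n-2)\cdots(n-\lfloor n/2\rfloor)}$$ is an integer. Moreover, this ratio gives $\Psi(\alpha,\beta,n)$, namely $$\Psi(\alpha,\beta,n)=\frac{\Omega_0\big(\lfloor n/2\rfloor\,|\,\alpha,\beta\,|\,n\big)}{(n-1)(n-2)\cdots(n-\lfloor n/2\rfloor)}.$$
   Context: For an integer $m\ge 0$, $\delta(m)\in\{0,1\}$ is the residue of $m$ modulo $2$. For $(a,b)\neq(0,0)$ the sequence $\Psi(n)=\Psi(a,b,n)$ is defined by $\Psi(0)=2$, $\Psi(1)=1$, $\Psi(n+1)=(2a-b)^{\delta(n)}\Psi(n)-a\Psi(n-1)$ for $n\ge1$ (with $t^0=1$ for every $t$). For a natural number $n$ and a point $(\zeta,\xi)\ne(0,0)$, the Omega sequence $\Omega_r(k|\zeta,\xi|n)$, for integers $r,k\ge 0$ with $r+k\le\lfloor n/2\rfloor$, is defined by $\Omega_r(0|\zeta,\xi|n)=1$ for all $r$ and, for $k\ge 1$, $$\Omega_r(k|\zeta,\xi|n)=(2\zeta-\xi)(n-r-k)\,\Omega_r(k-1|\zeta,\xi|n)-2\zeta\,(n-2r-\delta(n-1))\,\Omega_{r+1}(k-1|\zeta,\xi|n).$$ The denominator in the claim is $\prod_{j=1}^{\lfloor n/2\rfloor}(n-j)$; an empty product equals $1$.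
   Formalization: The ratio is claimed to be an integer only for integers α, β (for n = 2 it equals −β, so the claim fails for β = 1/2), while the identity with Ψ is for any numbers; n is at least 1, since for n = 0 the identity would read 2 = 1. *)

(* Defs.v *)
From HB Require Import structures.
From mathcomp Require Import all_boot all_order all_algebra.

Set Implicit Arguments.
Unset Strict Implicit.
Unset Printing Implicit Defensive.

Import GRing.Theory Num.Theory.
Local Open Scope ring_scope.

Definition delta (m : nat) : nat := (m %% 2)%N.

Fixpoint Psi (R : comNzRingType) (a b : R) (n : nat) : R :=
  match n with
  | 0 => 2
  | n1.+1 =>
    match n1 with
    | 0 => 1
    | n2.+1 => (2 * a - b) ^+ delta n1 * Psi a b n1 - a * Psi a b n2
    end
  end.

(* [Omega z x n r k] is Omega_r(k | z, x | n).  It is total in r and k, and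
   meaningful for r + k <= n./2, a range stable under the recursive calls.
   The differences are taken in R; in [n.-1] the predecessor of 0 is never
   relevant, since 0 < k <= n./2 forces 0 < n. *)
Fixpoint Omega (R : comNzRingType) (z x : R) (n r k : nat) {struct k} : R :=
  match k with
  | 0 => 1
  | k1.+1 =>
      (2 * z - x) * (n%:R - r%:R - k%:R) * Omega z x n r k1
      - 2 * z * (n%:R - 2 * r%:R - (delta n.-1)%:R) * Omega z x n r.+1 k1
  end.

(* [Num.int] would require R to be archimedean. *)
Definition is_integer (R : nzRingType) (t : R) : Prop :=
  exists m : int, t = m%:~R.

(* Main.v *)
Require Import Defs.
From mathcomp Require Import all_boot all_order all_algebra.
From mathcomp Require Import zify ring.

Import GRing.Theory Num.Theory.
Local Open Scope ring_scope.

(** Put [c = 2a - b].  Both sides of the identity are homogeneous polynomials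
    of degree [n./2] in [a] and [c], and they are compared coefficientwise.

    Unfolding the recursion for [Psi] produces the triangle of coefficients of
    the Lucas polynomials, [lucas n i = n / (n - i) * 'C(n - i, i)]: indeed if
    [a = u v] and [c = (u + v)^2] then [Psi n] is [u^n + v^n] for even [n] and
    [(u^n + v^n) / (u + v)] for odd [n] ([Psi_expansion]).

    Unfolding the recursion for [Omega_r(k)] is a sum over lattice paths with
    [k] steps, each of which either keeps [r] and lowers [k], or raises [r] and
    lowers [k].  A step of the first kind is weighted by a function of [r + k],
    which only steps of that kind change; a step of the second kind is weighted
    by a function of [r], which only steps of that kind change.  So the weight
    of a path depends only on the number [i] of steps of the second kind, there
    are ['C(k, i)] such paths, and [Omega] is a binomial sum
    ([Omega_expansion]).

    At [r = 0] and [k = n./2] the products telescope: [2 ^ i * n./2 ^_ i] is the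
    product of the [i] largest factors of [n ^_ i.*2] having one parity, and the
    weights of the second kind supply the factors of the other parity
    ([double_ffact]).  Comparison with the closed form of the Lucas triangle
    ([lucas_ffact]) identifies the coefficients.  Integrality of the ratio is
    then that of [Psi], a polynomial with integer coefficients. *)

(** The value 2 at the apex is the one of [u^0 + v^0]; it breaks the closed
    form [lucas_ffact], which therefore starts at row 1. *)
Fixpoint lucas (n i : nat) : nat :=
  match n, i with
  | 0, 0 => 2
  | 0, _.+1 => 0
  | n1.+1, 0 => 1
  | n1.+1, i1.+1 =>
    match n1 with
    | 0 => 0
    | n2.+1 => lucas n1 i1.+1 + lucas n2 i1
    end
  end.

Arguments lucas : simpl never.

Lemma lucasSS n i : lucas n.+2 i.+1 = (lucas n.+1 i.+1 + lucas n i)%N.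
Proof. by []. Qed.

Lemma lucas_small n i : (n < i.*2)%N -> lucas n i = 0%N.
Proof.
elim/ltn_ind: n i => [[|[|n]]] IHn [|i] // lt_n_i.
by rewrite lucasSS !IHn //; lia.
Qed.

(** For [2i <= n] this is [lucas n i = n (n-i-1)! / (i! (n-2i)!)] without
    denominators; for larger [i] both sides vanish. *)
Lemma lucas_ffact n i : (0 < n)%N ->
  (i`! * n.-1 ^_ i * lucas n i = n ^_ i.*2)%N.
Proof.
elim/ltn_ind: n i => [[|[|n]]] IHn [|i] // _; first by rewrite /= muln0.
have [lt_n_i|le_i_n] := ltnP n.+2 i.+1.*2.
  by rewrite lucas_small // muln0 ffact_small.
case: (posnP n) IHn le_i_n => [-> _ | n_gt0 IHn le_i_n]; first by case: i.
have lt_i_n : (i < n)%N by lia.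
have IH0 : (i`! * n.-1 ^_ i * lucas n i = n ^_ i.*2)%N by apply: IHn.
have IH1 : (i.+1 * i`! * (n ^_ i * (n - i)) * lucas n.+1 i.+1
    = n.+1 * (n ^_ i.*2 * (n - i.*2)))%N.
  by rewrite -factS -!ffactnSr -ffactSS -doubleS -IHn.
have shift : (n ^_ i * (n - i) = n * n.-1 ^_ i)%N by rewrite -ffactnSr ffactnS.
(* The factor [n - i] is the one by which the normalisations of the three
   entries related by [lucasSS] differ. *)
apply/eqP; rewrite -(eqn_pmul2l (_ : 0 < n - i)%N) ?subn_gt0 //; apply/eqP.
rewrite lucasSS factS doubleS [n.+2.-1]/= !ffactSS.
transitivity (n.+1 * (i.+1 * i`! * (n ^_ i * (n - i)) * lucas n.+1 i.+1)
  + i.+1 * n.+1 * i`! * lucas n i * (n ^_ i * (n - i)))%N; first by ring.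
rewrite IH1 shift.
transitivity (n.+1 * (n.+1 * (n ^_ i.*2 * (n - i.*2)))
  + i.+1 * n.+1 * n * (i`! * n.-1 ^_ i * lucas n i))%N; first by ring.
rewrite IH0.
transitivity ((n.+1 * (n - i.*2) + i.+1 * n) * (n.+1 * n ^_ i.*2))%N.
  by ring.
have -> : (n.+1 * (n - i.*2) + i.+1 * n = (n - i) * n.+2)%N by nia.
by ring.
Qed.

(** The recursion of the triangle is that of [Psi] read on coefficients: the
    term [- a * Psi n] shifts [i] by one, and the factor [c ^+ delta n.+1]
    makes up for the degree when [n.+2./2] exceeds [n.+1./2]. *)
Lemma Psi_expansion (R : comNzRingType) (a b : R) n :
  Psi a b n = \sum_(i < n./2.+1)
    (lucas n i)%:R * ((2 * a - b) ^+ (n./2 - i) * (- a) ^+ i).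
Proof.
elim/ltn_ind: n => [[|[|n]]] IHn.
- by rewrite big_ord1 /= !expr0 !mulr1.
- by rewrite big_ord1 /= !expr0 !mulr1.
set c := 2 * a - b.
have -> : Psi a b n.+2 = c ^+ delta n.+1 * Psi a b n.+1 - a * Psi a b n by [].
rewrite (IHn n) // (IHn n.+1) // -/c [n.+2./2]/=.
rewrite [RHS]big_ord_recl.
under [in RHS]eq_bigr => i _.
  rewrite lift0 lucasSS natrD mulrDl subSS.
  over.
rewrite big_split /= addrA; congr (_ + _); last first.
  rewrite -mulNr mulr_sumr; apply: eq_bigr => i _; rewrite exprS; ring.
transitivity (\sum_(i < n./2.+2)
    (lucas n.+1 i)%:R * (c ^+ (n./2.+1 - i) * (- a) ^+ i)); last first.
  by rewrite big_ord_recl; congr (_ + _); apply: eq_bigr.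
rewrite mulr_sumr uphalf_half /delta modn2 /=.
case: (boolP (odd n)) => odd_n /=.
  (* Here [n.+1./2 = n.+2./2], and the sums agree termwise; in the other case
     the extra term, of index [n./2.+1], has a zero coefficient. *)
  by rewrite add1n; apply: eq_bigr => i _; rewrite expr0 mul1r.
rewrite add0n [RHS]big_ord_recr /= lucas_small ?mul0r ?addr0; last by lia.
by apply: eq_bigr => i _; rewrite expr1 (subSn (ltnSE (ltn_ord i))) exprS; ring.
Qed.

(** The common weight of the [k]-step paths from [(r, k)] with [i] steps of the
    kind that raises [r]. *)
Definition path_weight {R : comNzRingType} (z x : R) (n r k i : nat) : R :=
  (2 * z - x) ^+ (k - i) * (- (2 * z)) ^+ i
  * \prod_((r + i).+1 <= s < (r + k).+1) (n%:R - s%:R)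
  * \prod_(r <= t < r + i) (n%:R - 2 * t%:R - (delta n.-1)%:R).

Lemma path_weight_keep (R : comNzRingType) (z x : R) n r k i : (i <= k)%N ->
  (2 * z - x) * (n%:R - r%:R - k.+1%:R) * path_weight z x n r k i
  = path_weight z x n r k.+1 i.
Proof.
move=> le_ik; rewrite /path_weight addnS [in RHS]big_nat_recr ?ltnS ?leq_add2l //=.
have -> : (r + k).+1%:R = r%:R + k.+1%:R :> R by rewrite -natrD addnS.
rewrite subSn // exprS; ring.
Qed.

Lemma path_weight_raise (R : comNzRingType) (z x : R) n r k i :
  - (2 * z * (n%:R - 2 * r%:R - (delta n.-1)%:R)) * path_weight z x n r.+1 k i
  = path_weight z x n r k.+1 i.+1.
Proof.
rewrite /path_weight !addnS !addSn subSS [in RHS](big_ltn (m := r)) ?ltnS ?leq_addr //.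
rewrite exprS; ring.
Qed.

Lemma sum_Pascal (R : pzRingType) (f : nat -> R) k :
  \sum_(i < k.+2) 'C(k.+1, i)%:R * f i
  = \sum_(i < k.+1) 'C(k, i)%:R * f i + \sum_(i < k.+1) 'C(k, i)%:R * f i.+1.
Proof.
rewrite big_ord_recl; under eq_bigr => i _ do rewrite lift0 binS natrD mulrDl.
rewrite big_split /= addrA; congr (_ + _).
rewrite [in LHS]big_ord_recr /= (bin_small (ltnSn k)) mul0r addr0.
by rewrite [in RHS]big_ord_recl !bin0.
Qed.

Lemma Omega_expansion (R : comNzRingType) (z x : R) n r k :
  Omega z x n r k = \sum_(i < k.+1) 'C(k, i)%:R * path_weight z x n r k i.
Proof.
elim: k r => [|k IHk] r.
  by rewrite big_ord1 /path_weight !addn0 !big_geq //= !mulr1.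
rewrite sum_Pascal /= -!mulNr !IHk !mulr_sumr; congr (_ + _).
  apply: eq_bigr => i _; rewrite -path_weight_keep; last by rewrite -ltnS.
  by rewrite mulrCA.
by apply: eq_bigr => i _; rewrite -path_weight_raise mulrCA !mulNr.
Qed.

Lemma prod_sub_ffact (R : comNzRingType) n i : (i < n)%N ->
  \prod_(1 <= j < i.+1) (n%:R - j%:R) = (n.-1 ^_ i)%:R :> R.
Proof.
elim: i => [|i IHi] lt_in; first by rewrite big_geq.
rewrite big_nat_recr //= IHi ?(ltnW lt_in) // ffactnSr natrM -natrB ?(ltnW lt_in) //.
by congr (_ * _%:R); lia.
Qed.

(** [2 * n./2] and [n - delta n.-1] are [n] and [n - 1] in some order, so the
    two progressions of step 2 that start there interleave. *)
Lemma double_ffact (R : comNzRingType) n i : (0 < n)%N -> (i <= n./2)%N ->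
  (n./2 ^_ i)%:R * 2 ^+ i
    * \prod_(0 <= t < i) (n%:R - 2 * t%:R - (delta n.-1)%:R)
  = (n ^_ i.*2)%:R :> R.
Proof.
move=> n_gt0; elim: i => [|i IHi] le_i; first by rewrite big_geq // !mulr1.
rewrite big_nat_recr //= ffactnSr exprS natrM doubleS !ffactnSr !natrM.
rewrite -IHi ?(ltnW le_i) //.
have -> : n%:R - 2 * i%:R - (delta n.-1)%:R
    = (n - i.*2 - delta n.-1)%:R :> R.
  rewrite /delta modn2 natrB ?natrB -?muln2 ?natrM ?[2 * _]mulrC //; lia.
have /(congr1 (fun m => m%:R : R)) : (2 * (n./2 - i) * (n - i.*2 - delta n.-1)
    = (n - i.*2) * (n - i.*2.+1))%N.
  by rewrite /delta modn2; case: (boolP (odd n)) => odd_n; nia.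
rewrite !natrM => step.
transitivity ((n./2 ^_ i)%:R * 2 ^+ i
  * \prod_(0 <= t < i) (n%:R - 2 * t%:R - (delta n.-1)%:R)
  * (2 * (n./2 - i)%:R * (n - i.*2 - delta n.-1)%:R) : R); first by ring.
by rewrite step; ring.
Qed.

Lemma path_weight_lucas (R : numFieldType) (z x : R) n i :
  (0 < n)%N -> (i <= n./2)%N ->
  'C(n./2, i)%:R * path_weight z x n 0 n./2 i
  = (lucas n i)%:R * ((2 * z - x) ^+ (n./2 - i) * (- z) ^+ i)
    * \prod_(1 <= j < n./2.+1) (n%:R - j%:R).
Proof.
move=> n_gt0 le_i; have lt_in : (i < n)%N by lia.
rewrite (big_cat_nat (n := i.+1)) //= prod_sub_ffact // /path_weight !add0n.
have fact_neq0 : i`!%:R != 0 :> R by rewrite pnatr_eq0 -lt0n fact_gt0.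
apply: (mulfI fact_neq0).
have closed : (n./2 ^_ i)%:R * 2 ^+ i
    * \prod_(0 <= t < i) (n%:R - 2 * t%:R - (delta n.-1)%:R)
    = i`!%:R * (n.-1 ^_ i)%:R * (lucas n i)%:R :> R.
  by rewrite double_ffact // -lucas_ffact // !natrM.
rewrite -bin_ffact natrM in closed.
rewrite -mulrN exprMn.
set P := \prod_(i.+1 <= _ < _) _; set Q := \prod_(0 <= _ < _) _ in closed *.
transitivity ((2 * z - x) ^+ (n./2 - i) * (- z) ^+ i * P
  * ('C(n./2, i)%:R * i`!%:R * 2 ^+ i * Q)); first by ring.
by rewrite closed; ring.
Qed.

Lemma Omega_Psi (R : numFieldType) (z x : R) n : (0 < n)%N ->
  Omega z x n 0 n./2
  = Psi z x n * \prod_(1 <= j < n./2.+1) (n%:R - j%:R).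
Proof.
move=> n_gt0; rewrite Omega_expansion Psi_expansion mulr_suml.
by apply: eq_bigr => i _; rewrite path_weight_lucas // -ltnS.
Qed.

Lemma rmorph_Psi {R S : comNzRingType} (f : {rmorphism R -> S}) (a b : R) n :
  f (Psi a b n) = Psi (f a) (f b) n.
Proof.
elim/ltn_ind: n => [[|[|n]]] IHn; first by rewrite rmorph_nat.
  by rewrite rmorph1.
have eqPsi (T : comNzRingType) (u v : T) :
  Psi u v n.+2 = (2 * u - v) ^+ delta n.+1 * Psi u v n.+1 - u * Psi u v n by [].
rewrite !eqPsi rmorphB !rmorphM rmorphXn rmorphB rmorphM rmorph_nat.
by rewrite !IHn.
Qed.

Theorem theorem31 (R : numFieldType) (n : nat) (alpha beta : R)
  (n_gt0 : (0 < n)%N) (ab_neq0 : (alpha, beta) <> (0, 0)) :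
  (is_integer alpha -> is_integer beta ->
   is_integer (Omega alpha beta n 0 n./2
               / \prod_(1 <= j < n./2.+1) (n%:R - j%:R)))
  /\
  Psi alpha beta n
    = Omega alpha beta n 0 n./2 / \prod_(1 <= j < n./2.+1) (n%:R - j%:R).
Proof.
have lt_half : (n./2 < n)%N by lia.
have PsiE : Psi alpha beta n
    = Omega alpha beta n 0 n./2 / \prod_(1 <= j < n./2.+1) (n%:R - j%:R).
  rewrite Omega_Psi // mulfK // prod_sub_ffact // pnatr_eq0 -lt0n ffact_gt0.
  by lia.
split=> // -[p alphaE] [q betaE]; rewrite -PsiE; exists (Psi p q n).
by rewrite alphaE betaE (rmorph_Psi (intr : {rmorphism int -> R})).
Qed.
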